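(* Consider bipartite graphs with a separated layout. (i) For all integers $s,q,k\ge 1$ and every $\Delta\in\mathbb{N}$, there are only finitely many separated $(s,q)$-critical graphs of maximum degree at most $\Delta$ and only finitely many separated $k$-critical graphs of maximum degree at most $\Delta$. (ii) There are only finitely many separated $(1,1)$-critical graphs and only finitely many separated $2$-critical graphs.
   Context: An ordered graph is a graph with a total order $\prec$ on its vertices. Two edges $uv$, $xy$ ($u\prec v$, $x\prec y$, four distinct endpoints) cross if $u\prec x\prec v\prec y$ or $x\prec u\prec y\prec v$ and nest if $u\prec x\prec y\prec v$ or $x\prec u\prec v\prec y$. A stack (queue) is an edge set with no two crossing (nesting) edges; an $s$-stack $q$-queue layout is a partition of the edges into $s$ stacks and $q$ queues with respect to the given order, and a mixed $k$-page layout is an $s$-stack $q$-queue layout for some $s,q\ge0$ with $s+q=k$. A separated graph is a bipartite graph with bipartition $V_1\cup V_2$ ordered so that all of $V_1$ precedes all of $V_2$. An ordered graph $G$ is $(s,q)$-critical if it admits no $s$-stack $q$-queue layout but $G-e$ does for every edge $e$; it is $k$-critical if it admits no mixed $k$-page layout but $G-e$ does for every edge $e$. Graphs are counted up to order-preserving isomorphism, disregarding isolated vertices. *)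

(* Defs.v *)
From HB Require Import structures.
From mathcomp Require Import all_boot all_order.

Set Implicit Arguments.
Unset Strict Implicit.
Unset Printing Implicit Defensive.

Import Order.TTheory.
Local Open Scope order_scope.

(* Finite simple ordered graphs. An edge {u, v} is encoded by its unique
   increasing pair (u, v) with u < v, so the set of such pairs is exactly
   the edge set and loops or parallel edges cannot occur. *)
Record ograph := OGraph {
  odisp : Order.disp_t;
  vertex : finOrderType odisp;
  edges : {set vertex * vertex};
  edges_lt : forall e, e \in edges -> e.1 < e.2
}.

Section Pairs.
Variables (d : Order.disp_t) (V : finOrderType d).
Implicit Types (e f : V * V) (A : {set V * V}).

(* The strict inequalities force the four endpoints to be distinct. *)
Definition cross e f : bool :=
  [&& e.1 < f.1, f.1 < e.2 & e.2 < f.2] ||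
  [&& f.1 < e.1, e.1 < f.2 & f.2 < e.2].

Definition nest e f : bool :=
  [&& e.1 < f.1, f.1 < f.2 & f.2 < e.2] ||
  [&& f.1 < e.1, e.1 < e.2 & e.2 < f.2].

Definition is_stack A : Prop := {in A &, forall e f, ~~ cross e f}.
Definition is_queue A : Prop := {in A &, forall e f, ~~ nest e f}.
End Pairs.

(* Pages are indexed by the disjoint sum: inl for stacks, inr for queues.
   Pages may be empty. *)
Definition sq_layout (s q : nat) (G : ograph) : Prop :=
  exists P : 'I_s + 'I_q -> {set vertex G * vertex G},
    [/\ \bigcup_i P i = edges G,
        forall i j, i != j -> [disjoint P i & P j],
        forall i : 'I_s, is_stack (P (inl i)) &
        forall j : 'I_q, is_queue (P (inr j))].

Definition mixed_layout (k : nat) (G : ograph) : Prop :=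
  exists s q : nat, (s + q)%N = k /\ sq_layout s q G.

Lemma del_edge_lt (G : ograph) (e f : vertex G * vertex G) :
  f \in edges G :\ e -> f.1 < f.2.
Proof. by case/setD1P=> _; apply: edges_lt. Qed.

Definition del_edge (G : ograph) (e : vertex G * vertex G) : ograph :=
  OGraph (@del_edge_lt G e).

Definition critical (layout : ograph -> Prop) (G : ograph) : Prop :=
  ~ layout G /\ forall e, e \in edges G -> layout (del_edge e).

Definition sq_critical (s q : nat) : ograph -> Prop :=
  critical (sq_layout s q).

Definition k_critical (k : nat) : ograph -> Prop :=
  critical (mixed_layout k).

Definition separated (G : ograph) : Prop :=
  exists V1 V2 : {set vertex G},
    [/\ V1 :|: V2 = setT,
        [disjoint V1 & V2],
        forall e, e \in edges G ->
          (e.1 \in V1) && (e.2 \in V2) || (e.1 \in V2) && (e.2 \in V1) &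
        {in V1 & V2, forall x y, x < y}].

Definition adj (G : ograph) (x y : vertex G) : bool :=
  ((x, y) \in edges G) || ((y, x) \in edges G).

Definition degree (G : ograph) (x : vertex G) : nat :=
  #|[set y | adj x y]|.

Definition maxdeg_le (D : nat) (G : ograph) : Prop :=
  forall x : vertex G, (degree x <= D)%N.

Definition nonisolated (G : ograph) : {set vertex G} :=
  [set x | [exists y, adj x y]].

(* Order-preserving isomorphism after discarding isolated vertices. *)
Definition ograph_iso (G H : ograph) : Prop :=
  exists f : {x | x \in nonisolated G} -> {y | y \in nonisolated H},
    [/\ bijective f,
        forall x y, (val (f x) < val (f y)) = (val x < val y) &
        forall x y, adj (val (f x)) (val (f y)) = adj (val x) (val y)].

(* Finitely many up to isomorphism: a finite family of representatives
   meets every isomorphism class occurring in P. *)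
Definition finitely_many (P : ograph -> Prop) : Prop :=
  exists (N : nat) (L : 'I_N -> ograph),
    forall G, P G -> exists i, ograph_iso G (L i).

(* Main.v *)
(* In a separated layout, crossing and nesting are the symmetric closures of
   two strict orders, so by Mirsky's theorem an edge set E has an s-stack
   q-queue layout iff it splits into a part without (s+1)-twist and a part
   without (q+1)-rainbow. It remains to find, in a set with no such splitting,
   a subset of bounded size that has none either.

   A set with neither an (s+1)-twist nor a (q+1)-rainbow is covered by s * q
   stars. Hence, for bounded degree, two splittings differ in a bounded number
   of edges. Remove one edge e from a minimal non-splittable E, split the rest,
   and search from there: a violated twist or rainbow must contain an edge on
   which any given valid splitting disagrees with the current one, so a search
   tree of bounded depth and branching meets all the edges needed.

   For s = q = 1 the degree may be unbounded, but the problem is a 2-SAT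
   instance: fix the page of e and propagate along conflicts. The edges flipped
   to a given page lie in one star, and two stars admit only short
   propagation paths. *)
Require Import Defs.
From mathcomp Require Import all_boot all_order zify.

Set Implicit Arguments.
Unset Strict Implicit.
Unset Printing Implicit Defensive.

Import Order.TTheory.

Lemma leq_card_bigcup (I T : finType) (P : pred I) (F : I -> {set T}) :
  #|\bigcup_(i | P i) F i| <= \sum_(i | P i) #|F i|.
Proof.
elim/big_rec2: _ => [|i n A _ leAn]; first by rewrite cards0.
by rewrite (leq_trans (leq_card_setU _ _)) // leq_add2l.
Qed.

(** * Bounded obstructions to splitting a set into two constrained parts *)

Section Splittings.
Variables (T : finType) (Ba Bb : pred {set T}).
Implicit Types (E F A S X : {set T}).

(** [A] ranges over all sets, not only subsets of [E], so the same [A] also splits every subset of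
    [E]. *)
Definition split_by E A :=
  [forall X : {set T}, (X \subset E :&: A) ==> ~~ Ba X] &&
  [forall X : {set T}, (X \subset E :\: A) ==> ~~ Bb X].

Definition splittable E := [exists A, split_by E A].

Lemma split_byP E A :
  reflect ((forall X, X \subset E :&: A -> ~~ Ba X) /\
           (forall X, X \subset E :\: A -> ~~ Bb X)) (split_by E A).
Proof.
apply: (iffP andP) => -[/= hA hB]; split.
- by move=> X; move/forallP: hA => /(_ X)/implyP.
- by move=> X; move/forallP: hB => /(_ X)/implyP.
- by apply/forallP => X; apply/implyP/hA.
- by apply/forallP => X; apply/implyP/hB.
Qed.

Lemma split_byS E F A : F \subset E -> split_by E A -> split_by F A.
Proof.
move=> sFE /split_byP[hA hB]; apply/split_byP; split=> X sX.
- by apply/hA/(subset_trans sX)/setSI.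
- by apply/hB/(subset_trans sX)/setSD.
Qed.

Lemma splittableS E F : F \subset E -> splittable E -> splittable F.
Proof. by move=> sFE /existsP[A sA]; apply/existsP; exists A; apply: split_byS sA. Qed.

Definition disagree F A A' := [set x in F | (x \in A) != (x \in A')].

Definition flip A x := [set y | (y \in A) (+) (y == x)].

Variable m : nat.
Hypothesis (Ba_small : forall X, Ba X -> #|X| <= m).
Hypothesis (Bb_small : forall X, Bb X -> #|X| <= m).

(** [X] is a forbidden set that [A] keeps on one side, so a valid [A'] must move one of its
    elements. [X] is chosen before [F] and [A'], which lets the search proceed without knowing
    [A']. *)
Lemma violated E A : ~~ split_by E A ->
  exists X, [/\ X \subset E, #|X| <= m &
    forall F A', X \subset F -> split_by F A' ->
      exists2 x, x \in X & (x \in A) != (x \in A')].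
Proof.
rewrite negb_and => /orP[]; rewrite negb_forall => /existsP[X];
  rewrite negb_imply negbK => /andP[/subsetP sX BX]; exists X; split.
- by apply/subsetP => x /sX; rewrite inE => /andP[].
- exact: Ba_small.
- move=> F A' sXF /split_byP[hA _].
  have: ~~ (X \subset F :&: A') by apply: contraL BX => /hA.
  case/subsetPn => x xX; rewrite inE (subsetP sXF) //= => xA'.
  by exists x => //; move/sX: xX; rewrite inE (negPf xA') => /andP[_ ->].
- by apply/subsetP => x /sX; rewrite inE => /andP[].
- exact: Bb_small.
- move=> F A' sXF /split_byP[_ hB].
  have: ~~ (X \subset F :\: A') by apply: contraL BX => /hB.
  case/subsetPn => x xX; rewrite inE (subsetP sXF) //= andbT negbK => xA'.
  by exists x => //; move/sX: xX; rewrite inE xA' => /andP[/negPf-> _].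
Qed.

(** A violated set has at most [m] elements, and each of them opens a branch of depth one less. *)
Definition search_bound n := iter n (fun b => m + m * b) 0.

(* Every valid splitting repairs a violated constraint by disagreeing with
   the current one somewhere on it; flip that element and repeat. *)
Lemma local_search E : ~~ splittable E -> forall n A,
  exists F, [/\ F \subset E, #|F| <= search_bound n &
    forall A', split_by F A' -> n <= #|disagree F A A'|].
Proof.
move=> nE; elim=> [|n IHn] A.
  by exists set0; rewrite sub0set cards0.
have /violated[X [sXE cX hX]] : ~~ split_by E A.
  by apply: contra nE => sA; apply/existsP; exists A.
have [G hG] := fin_all_exists (fun x => IHn (flip A x)).
exists (X :|: \bigcup_(x in X) G x); split.
- by rewrite subUset sXE; apply/bigcupsP => x _; case: (hG x).
- rewrite (leq_trans (leq_card_setU _ _)) //= leq_add //.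
  rewrite (leq_trans (leq_card_bigcup _ _)) //.
  apply: (@leq_trans (\sum_(x in X) search_bound n)).
    by apply: leq_sum => x _; case: (hG x).
  by rewrite sum_nat_const leq_mul2r cX orbT.
- move=> A' sA'; have [x xX Ax] := hX _ _ (subsetUl _ _) sA'.
  have sGF : G x \subset X :|: \bigcup_(x in X) G x.
    by rewrite subsetU // (bigcup_sup x) ?orbT.
  have [_ _ /(_ _ (split_byS sGF sA')) hn] := hG x.
  (* Flipping [x], on which [A] and [A'] disagree, removes [x] from the disagreement and adds
     nothing. *)
  apply: leq_ltn_trans hn _; apply/proper_card/properP; split.
    apply/subsetP => y; rewrite !inE => /andP[/(subsetP sGF)].
    rewrite !inE => ->; case: (y =P x) => [->|_] /=; last by rewrite addbF.
    by move: Ax; do 2!case: (_ \in _).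
  exists x; first by rewrite !inE xX.
  by rewrite !inE eqxx; move: Ax; do 2!case: (_ \in _); rewrite ?andbF.
Qed.

(** Let [A0] split a minimal unsplittable [E0] minus [e], and search from [A0]. If some [A'] split
    the set [F] found, the disagreement away from [e] would consist of two sets, one per direction,
    each free of both kinds of forbidden sets and so of size at most [r]. Together with [e] this is
    at most [2r + 1], one below the search depth. *)
Lemma small_obstruction r E :
    (forall S, S \subset E -> (forall X, X \subset S -> ~~ Ba X) ->
       (forall X, X \subset S -> ~~ Bb X) -> #|S| <= r) ->
    ~~ splittable E ->
  exists F, [/\ F \subset E, ~~ splittable F & #|F| <= search_bound r.*2.+2].
Proof.
move=> hr nE.
have [E0 /minsetP[nE0 minE0] sE0] := @minset_exists _ (fun F => ~~ splittable F) _ nE.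
have [E0_0|[e eE0]] := set_0Vmem E0.
  by exists E0; rewrite E0_0 cards0 -E0_0.
have /existsP[A0 /split_byP[hA0 hB0]] : splittable (E0 :\ e).
  apply/contraT => /minE0 /(_ (subsetDl _ _))/setP/(_ e).
  by rewrite !inE eqxx eE0.
have [F [sF cF hF]] := local_search nE0 r.*2.+2 A0.
exists F; split=> //; first exact: subset_trans sE0.
apply/negP => /existsP[A' sA'].
suff: #|disagree F A0 A'| < r.*2.+2 by rewrite ltnNge hF.
have /split_byP[hA' hB'] := sA'.
set S1 := (F :&: A0 :\: A') :\ e; set S2 := (F :&: A' :\: A0) :\ e.
have sD : disagree F A0 A' \subset e |: (S1 :|: S2).
  apply/subsetP => x; rewrite !inE => /andP[->]; case: (x =P e) => //= _.
  by do 2!case: (x \in _).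
have FE := subset_trans sF sE0.
(* [A0] excludes [Ba] from [S1] and [A'] excludes [Bb]; for [S2] the roles are exchanged. *)
have c1 : #|S1| <= r.
  apply: hr => [|X sX|X sX].
  - apply: subset_trans FE; apply/subsetP => x; rewrite !inE.
    by case/and4P.
  - apply/hA0/(subset_trans sX)/subsetP => x; rewrite !inE.
    by case/and4P => -> _ /(subsetP sF)-> ->.
  - apply/hB'/(subset_trans sX)/subsetP => x; rewrite !inE.
    by case/and4P => _ -> ->.
have c2 : #|S2| <= r.
  apply: hr => [|X sX|X sX].
  - apply: subset_trans FE; apply/subsetP => x; rewrite !inE.
    by case/and4P.
  - apply/hA'/(subset_trans sX)/subsetP => x; rewrite !inE.
    by case/and4P => _ _ -> ->.
  - apply/hB0/(subset_trans sX)/subsetP => x; rewrite !inE.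
    by case/and4P => -> -> /(subsetP sF)-> _.
apply: leq_ltn_trans (subset_leq_card sD) _; rewrite ltnS.
rewrite (leq_trans (leq_card_setU _ _)) // cards1 add1n ltnS.
by rewrite (leq_trans (leq_card_setU _ _)) // -addnn leq_add.
Qed.
End Splittings.

(** * Two-colourings under pairwise conflicts, with bounded propagation *)

Section TwoColouring.
Variables (T : finType) (conf : bool -> rel T).
Hypothesis conf_sym : forall b, symmetric (conf b).
Implicit Types (E F A S : {set T}) (x y : T) (b : bool).

(* [A] is the colour class [true]; [conf b x y] forbids giving [x] and [y] both
   the colour [b]. *)
Definition colouring E A :=
  [forall x in E, forall y in E, ((x \in A) == (y \in A)) ==> ~~ conf (x \in A) x y].

Definition colourable E := [exists A, colouring E A].

Lemma colouringP E A :
  reflect {in E &, forall x y, (x \in A) = (y \in A) -> ~~ conf (x \in A) x y}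
          (colouring E A).
Proof.
apply: (iffP forall_inP) => [h x y xE yE /eqP|h x xE].
  by move: x xE y yE => x /h/forall_inP h' y /h' /implyP.
by apply/forall_inP => y yE; apply/implyP => /eqP; apply: h.
Qed.

Definition compat x y := forall b, ~~ conf b x y.

(** Five alternating conflicts along u1, v1, u2, v2, u3, v3 can be replaced by a single one from u1
    to v3. This is what bounds the propagation depth. *)
Definition shortcut := forall b u1 u2 u3 v1 v2 v3,
  compat u1 u2 -> compat u2 u3 -> compat u1 u3 ->
  compat v1 v2 -> compat v2 v3 -> compat v1 v3 ->
  conf (~~ b) u1 v1 -> conf b v1 u2 -> conf (~~ b) u2 v2 -> conf b v2 u3 ->
  conf (~~ b) u3 v3 -> conf (~~ b) u1 v3.

Lemma colouringS E F A : F \subset E -> colouring E A -> colouring F A.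
Proof.
by move=> /subsetP sFE /colouringP cA; apply/colouringP => x y /sFE + /sFE; apply: cA.
Qed.

Section Propagation.
Variables (E : {set T}) (e : T) (b0 : bool).

(** [F] is a certificate of the deduction; its size is tracked because certificates are later united
    into an obstruction. *)
Definition forced k b x := exists F, [/\ F \subset E, #|F| <= k, e \in F, x \in F &
  forall A, colouring F A -> (e \in A) = b0 -> (x \in A) = b].

Definition refuted k := exists F, [/\ F \subset E, #|F| <= k, e \in F &
  forall A, colouring F A -> (e \in A) <> b0].

Lemma forced_refl : e \in E -> forced 1 b0 e.
Proof. by move=> eE; exists [set e]; rewrite cards1 sub1set set11. Qed.

Lemma forcedW k l b x : k <= l -> forced k b x -> forced l b x.
Proof.
by move=> lekl [F [? cF ? ? hF]]; exists F; split=> //; apply: leq_trans cF lekl.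
Qed.

Lemma forced_step k b x y :
  y \in E -> conf b x y -> forced k b x -> forced k.+1 (~~ b) y.
Proof.
move=> yE bxy [F [sF cF eF xF hF]]; exists (y |: F); split.
- by rewrite subUset sub1set yE.
- by rewrite (leq_trans (leq_card_setU _ _)) // cards1.
- by rewrite !inE eF orbT.
- by rewrite setU11.
- move=> A cA eA; have xA : (x \in A) = b.
    by apply: hF => //; apply: colouringS cA; rewrite subsetUr.
  apply/eqP; move: bxy; apply: contraLR; rewrite -{1}xA => neq.
  rewrite -xA; apply: (colouringP _ _ cA); rewrite ?setU11 ?inE ?xF ?orbT //.
  by move: neq; do 2!case: (_ \in A).
Qed.

Lemma forced_clash k l b x y :
  conf b x y -> forced k b x -> forced l b y -> refuted (k + l).
Proof.
move=> bxy [F [sF cF eF xF hF]] [G [sG cG eG yG hG]].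
exists (F :|: G); split.
- by rewrite subUset sF.
- by rewrite (leq_trans (leq_card_setU _ _)) // leq_add.
- by rewrite inE eF.
- move=> A cA eA; have xA : (x \in A) = b.
    by apply: hF => //; apply: colouringS cA; rewrite subsetUl.
  have yA : (y \in A) = b.
    by apply: hG => //; apply: colouringS cA; rewrite subsetUr.
  have := colouringP _ _ cA x y; rewrite !inE xF yG orbT xA yA bxy => /(_ isT isT erefl).
  by [].
Qed.

Variable A0 : {set T}.

(** One round of propagation: the elements that must leave their old colour [b] once all of [S] has
    colour [b]. *)
Definition spread b S :=
  [set y in E :\ e | ((y \in A0) == b) && [exists x in S, conf b x y]].

Lemma spreadP b S y :
  reflect (exists2 x, x \in S & conf b x y /\ [/\ y \in E, y != e & (y \in A0) = b])
          (y \in spread b S).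
Proof.
rewrite !inE; apply: (iffP and3P) => [[/andP[? ?] /eqP ? /exists_inP[x xS ?]]|].
  by exists x.
case=> x xS [bxy [-> -> ->]]; split=> //.
by apply/exists_inP; exists x.
Qed.

Lemma forced_spread k b S : {in S, forall x, forced k b x} ->
  {in spread b S, forall y, forced k.+1 (~~ b) y}.
Proof.
move=> hS y /spreadP[x xS [bxy [yE _ _]]].
by apply: forced_step bxy _ => //; apply: hS.
Qed.

Hypothesis cA0 : colouring (E :\ e) A0.

Lemma old_pages b x y : x \in E -> x != e -> (x \in A0) = b ->
  y \in E -> y != e -> (y \in A0) = b -> ~~ conf b x y.
Proof.
move=> xE xe xA yE ye yA; rewrite -xA; apply: (colouringP _ _ cA0); rewrite ?inE ?xe ?ye //.
by rewrite xA yA.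
Qed.

(** Give [Q0] colour [b0], the rest of [Q1] the other colour, and keep [A0] elsewhere. Closure rules
    out conflicts between recoloured and untouched elements; two untouched elements differ from [e],
    so [A0] already separates their conflicts. *)
Lemma recolour (Q0 Q1 : {set T}) : e \in Q0 ->
    {in Q0 &, forall x y, ~~ conf b0 x y} ->
    {in Q1 &, forall x y, ~~ conf (~~ b0) x y} ->
    (forall x y, x \in Q0 -> y \in E -> y != e -> (y \in A0) = b0 ->
       conf b0 x y -> y \in Q1) ->
    (forall x y, x \in Q1 -> y \in E -> y != e -> (y \in A0) = ~~ b0 ->
       conf (~~ b0) x y -> y \in Q0) ->
  colourable E.
Proof.
move=> eQ0 nQ0 nQ1 clos0 clos1.
pose col y := if y \in Q0 then b0 else if y \in Q1 then ~~ b0 else y \in A0.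
have colP y : y \in E -> [\/ y \in Q0 /\ col y = b0, y \in Q1 /\ col y = ~~ b0 |
    y != e /\ (y \in A0) = col y].
  move=> yE; rewrite /col; case: ifP => yQ0; first by constructor 1.
  case: ifP => yQ1; first by constructor 2.
  by constructor 3; split=> //; apply: contraFneq yQ0 => ->.
have mixed x y : x \in E -> y \in E -> col x = col y ->
    x \in Q0 \/ x \in Q1 -> ~~ conf (col x) x y.
  move=> xE yE; rewrite /col.
  case: ifP => xQ0 + hx; last first.
    have xQ1 : x \in Q1 by case: hx.
    rewrite xQ1; case: ifP => yQ0; first by case: (b0).
    case: ifP => yQ1 => [_|eqc]; first exact: nQ1.
    have ye : y != e by apply: contraFneq yQ0 => ->.
    by apply: contraFN yQ0; apply: clos1 xQ1 yE ye (esym eqc).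
  case: ifP => yQ0; first by move=> _; apply: nQ0.
  case: ifP => yQ1 => [|eqc]; first by case: (b0).
  have ye : y != e by apply: contraFneq yQ0 => ->.
  by apply: contraFN yQ1; apply: clos0 xQ0 yE ye (esym eqc).
apply/existsP; exists [set y | col y]; apply/colouringP => x y xE yE; rewrite !inE => eqc.
have [[xQ _]|[xQ _]|[xe xA]] := colP x xE; first by apply: mixed; auto.
  by apply: mixed; auto.
have [[yQ _]|[yQ _]|[ye yA]] := colP y yE.
- by rewrite eqc conf_sym; apply: mixed; auto.
- by rewrite eqc conf_sym; apply: mixed; auto.
- by apply: (old_pages xE xe xA yE ye); rewrite yA.
Qed.

(* Only elements whose colour differs from [A0] propagate further. As long as
   no clash occurs, the flipped elements of one colour are pairwise
   compatible, so [shortcut] makes the propagation stop after six steps. *)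
Lemma refute_colour : shortcut -> e \in E -> ~~ colourable E -> refuted 14.
Proof.
move=> hsc eE nE.
move DP1: (spread b0 [set e]) => P1; move DP2: (spread (~~ b0) P1) => P2.
move DP3: (spread b0 P2) => P3; move DP4: (spread (~~ b0) P3) => P4.
move DP5: (spread b0 P4) => P5; move DP6: (spread (~~ b0) P5) => P6.
pose Q0 := e |: (P2 :|: P4 :|: P6); pose Q1 := P1 :|: P3 :|: P5.
have inQ0 x : (x \in Q0) = [|| x == e, x \in P2, x \in P4 | x \in P6].
  by rewrite !in_setU in_set1 -orbA.
have inQ1 x : (x \in Q1) = [|| x \in P1, x \in P3 | x \in P5].
  by rewrite !in_setU -orbA.
have f0 : {in [set e], forall x, forced 1 b0 x}.
  by move=> x /set1P->; apply: forced_refl.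
have := forced_spread f0; rewrite DP1 => f1.
have := forced_spread f1; rewrite DP2 negbK => f2.
have := forced_spread f2; rewrite DP3 => f3.
have := forced_spread f3; rewrite DP4 negbK => f4.
have := forced_spread f4; rewrite DP5 => f5.
have := forced_spread f5; rewrite DP6 negbK => f6.
(* A certificate starts with one element and gains one per round, hence at most 7 after six rounds;
   a clash unites two of them, giving 14. *)
have fQ0 : {in Q0, forall x, forced 7 b0 x}.
  move=> x; rewrite inQ0 -in_set1.
  by case/or4P => [/f0|/f2|/f4|/f6]; apply: forcedW.
have fQ1 : {in Q1, forall x, forced 7 (~~ b0) x}.
  by move=> x; rewrite inQ1; case/or3P => [/f1|/f3|/f5]; apply: forcedW.
have [/exists_inP[x xQ /exists_inP[y yQ cxy]]|] :=
    boolP [exists x in Q0, exists y in Q0, conf b0 x y].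
  exact: forced_clash cxy (fQ0 _ xQ) (fQ0 _ yQ).
rewrite negb_exists_in => /forall_inP nQ0.
have {}nQ0 : {in Q0 &, forall x y, ~~ conf b0 x y}.
  by move=> x y /nQ0; rewrite negb_exists_in => /forall_inP; apply.
have [/exists_inP[x xQ /exists_inP[y yQ cxy]]|] :=
    boolP [exists x in Q1, exists y in Q1, conf (~~ b0) x y].
  exact: forced_clash cxy (fQ1 _ xQ) (fQ1 _ yQ).
rewrite negb_exists_in => /forall_inP nQ1.
have {}nQ1 : {in Q1 &, forall x y, ~~ conf (~~ b0) x y}.
  by move=> x y /nQ1; rewrite negb_exists_in => /forall_inP; apply.
(* Flipped elements are compatible in their new colour since no clash occurred, and in their old
   colour since [A0] was valid. The element [e] is left out because it has no valid old colour. *)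
have cQ0 x y : x \in P2 :|: P4 :|: P6 -> y \in P2 :|: P4 :|: P6 -> compat x y.
  move=> xQ yQ b; have [->|nb] := eqVneq b b0.
    by apply: nQ0; rewrite in_setU1 ?xQ ?yQ orbT.
  have -> : b = ~~ b0 by move: nb; case: (b); case: (b0).
  have o z : z \in P2 :|: P4 :|: P6 -> [/\ z \in E, z != e & (z \in A0) = ~~ b0].
    by rewrite !in_setU -DP2 -DP4 -DP6 => /orP[/orP[]|] /spreadP[? _ [_ []]].
  by have [? ? ?] := o _ xQ; have [? ? ?] := o _ yQ; apply: old_pages.
have cQ1 x y : x \in Q1 -> y \in Q1 -> compat x y.
  move=> xQ yQ b; have [->|nb] := eqVneq b (~~ b0); first exact: nQ1.
  have -> : b = b0 by move: nb; case: (b); case: (b0).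
  have o z : z \in Q1 -> [/\ z \in E, z != e & (z \in A0) = b0].
    by rewrite inQ1 -DP1 -DP3 -DP5 => /or3P[] /spreadP[? _ [_ []]].
  by have [? ? ?] := o _ xQ; have [? ? ?] := o _ yQ; apply: old_pages.
(* Trace an element of [P6] back to some [u1] in [P1]; the shortcut makes it a direct successor of
   [u1]. A seventh round from [P6] therefore stays inside [P3], and [Q0], [Q1] are closed. *)
have sP62 : {subset P6 <= P2}.
  move=> v3 v36; have := v36; rewrite -DP6 => /spreadP[u3 u35 [c5 v3o]].
  have := u35; rewrite -DP5 => /spreadP[v2 v24 [c4 _]].
  have := v24; rewrite -DP4 => /spreadP[u2 u23 [c3 _]].
  have := u23; rewrite -DP3 => /spreadP[v1 v12 [c2 _]].
  have := v12; rewrite -DP2 => /spreadP[u1 u11 [c1 _]].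
  apply/spreadP; exists u1 => //; split=> //.
  have q1 : u1 \in Q1 by rewrite inQ1 u11.
  have q2 : u2 \in Q1 by rewrite inQ1 u23 orbT.
  have q3 : u3 \in Q1 by rewrite inQ1 u35 !orbT.
  have r1 : v1 \in P2 :|: P4 :|: P6 by rewrite !in_setU v12.
  have r2 : v2 \in P2 :|: P4 :|: P6 by rewrite !in_setU v24 orbT.
  have r3 : v3 \in P2 :|: P4 :|: P6 by rewrite !in_setU v36 orbT.
  exact: (hsc _ _ _ _ _ _ _ (cQ1 _ _ q1 q2) (cQ1 _ _ q2 q3) (cQ1 _ _ q1 q3)
    (cQ0 _ _ r1 r2) (cQ0 _ _ r2 r3) (cQ0 _ _ r1 r3) c1 c2 c3 c4 c5).
have clos0 x y : x \in Q0 -> y \in E -> y != e -> (y \in A0) = b0 ->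
    conf b0 x y -> y \in Q1.
  rewrite inQ0 inQ1 => xQ yE ye yA cxy.
  have inP S P : spread b0 S = P -> x \in S -> y \in P by move=> <- xS; apply/spreadP; exists x.
  by case/or4P: xQ => [|/(inP _ _ DP3)->|/(inP _ _ DP5)->|/sP62/(inP _ _ DP3)->];
    rewrite ?orbT // -in_set1 => /(inP _ _ DP1)->.
have clos1 x y : x \in Q1 -> y \in E -> y != e -> (y \in A0) = ~~ b0 ->
    conf (~~ b0) x y -> y \in Q0.
  rewrite inQ0 inQ1 => xQ yE ye yA cxy.
  have inP S P : spread (~~ b0) S = P -> x \in S -> y \in P by move=> <- xS; apply/spreadP; exists x.
  by case/or3P: xQ => [/(inP _ _ DP2)->|/(inP _ _ DP4)->|/(inP _ _ DP6)->]; rewrite ?orbT.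
have eQ0 : e \in Q0 by rewrite inQ0 eqxx.
by case/negP: nE; apply: recolour eQ0 nQ0 nQ1 clos0 clos1.
Qed.

End Propagation.

(** In a minimal uncolourable set, either colour of a fixed [e] is refuted within 14 elements; the
    union of the two refutations is uncolourable. *)
Lemma colouring_obstruction E : shortcut -> ~~ colourable E ->
  exists F, [/\ F \subset E, ~~ colourable F & #|F| <= 28].
Proof.
move=> hsc nE.
have [E0 /minsetP[nE0 minE0] sE0] := @minset_exists _ (fun F => ~~ colourable F) _ nE.
have [E0_0|[e eE0]] := set_0Vmem E0; first by exists E0; rewrite E0_0 cards0 -E0_0.
have /existsP[A0 cA0] : colourable (E0 :\ e).
  apply/contraT => /minE0 /(_ (subsetDl _ _))/setP/(_ e).
  by rewrite !inE eqxx eE0.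
have [F [sF cF eF hF]] := refute_colour true cA0 hsc eE0 nE0.
have [G [sG cG eG hG]] := refute_colour false cA0 hsc eE0 nE0.
exists (F :|: G); split.
- by rewrite subUset !(subset_trans _ sE0).
- apply/negP => /existsP[A cA]; case eA: (e \in A).
    by apply: hF eA; apply: colouringS cA; apply: subsetUl.
  by apply: hG eA; apply: colouringS cA; apply: subsetUr.
- by rewrite (leq_trans (leq_card_setU _ _)) // (leq_add cF cG).
Qed.
End TwoColouring.

(** * Mirsky's theorem: chains and antichain partitions *)

Section Chains.
Variables (T : finType) (lt : rel T).
Implicit Types (S X : {set T}) (p : seq T) (k : nat).

Definition chain k X := [exists t : k.-tuple T, sorted lt t && (X == [set x in t])].

Lemma card_chain k X : chain k X -> #|X| <= k.
Proof.
by case/existsP => t /andP[_ /eqP->]; rewrite cardsE (leq_trans (card_size _)) ?size_tuple.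
Qed.

Definition antichain_colouring k S (c : T -> nat) :=
  {in S, forall x, c x < k} /\ {in S &, forall x y, c x = c y -> ~~ lt x y}.

(** Peel off the minimal elements [M] as the last colour class. A chain outside [M] extends
    downwards by one element, so the longest chain shrinks. *)
Lemma mirsky_seq k S :
    (forall p, size p = k.+1 -> sorted lt p -> ~ {subset p <= S}) ->
  exists c, antichain_colouring k S c.
Proof.
elim: k S => [|k IHk] S hS.
  have S0 x : x \in S -> False by move=> xS; apply: (hS [:: x]) => // y /[!inE]/eqP->.
  by exists (fun=> 0); split=> x; [move/S0|move=> ? /S0].
pose M := [set x in S | [forall y in S, ~~ lt y x]].
have [p sp lp pS|c [ck cP]] := IHk (S :\: M).
  case: p sp lp pS => // x p [sp] lp pS.
  have /setDP[xS] := pS x (mem_head _ _).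
  rewrite inE xS negb_forall_in => /exists_inP[y yS]; rewrite negbK => yx.
  apply: (hS [:: y, x & p]) => /=; rewrite ?sp ?yx // => z.
  by rewrite in_cons => /predU1P[->|/pS/setDP[]].
exists (fun x => if x \in M then k else c x); split=> [x xS|x y xS yS].
  by case: ifPn => // xM; rewrite ltnW // ltnS ck // inE xM.
case: ifPn => xM; case: ifPn => yM.
- by move: yM; rewrite inE => /andP[_ /forall_inP->].
- by move=> kc; have := ck y; rewrite -kc ltnn inE yM yS => /(_ isT).
- by move: yM; rewrite inE => /andP[_ /forall_inP->].
- by apply: cP; rewrite inE ?xM ?yM.
Qed.

Lemma mirsky k S : (forall X, X \subset S -> ~~ chain k.+1 X) ->
  exists c, antichain_colouring k S c.
Proof.
move=> hS; apply: mirsky_seq => p sp lp pS.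
have /hS/negP[] : [set x in p] \subset S by apply/subsetP => x; rewrite inE => /pS.
have /eqP sp' := sp; apply/existsP; exists (Tuple sp'); rewrite /= lp /=.
by apply/eqP/setP => x; rewrite !inE.
Qed.

(** By transitivity any two members of a chain are related, so their colours are distinct, and there
    are only [k] colours. *)
Lemma chain_free k S (c : T -> nat) : transitive lt ->
  antichain_colouring k S c -> forall X, X \subset S -> ~~ chain k.+1 X.
Proof.
move=> ltT [ck cP] X /subsetP XS; apply/negP => /existsP[t /andP[lt_t /eqP Xt]].
have tS : {subset t <= S} by move=> x xt; apply: XS; rewrite Xt inE.
have ut : uniq (map c t).
  rewrite uniq_pairwise pairwise_map; rewrite sorted_pairwise // in lt_t.
  apply: (sub_in_pairwise (P := mem S)) lt_t; last exact/allP.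
  by move=> x y xS yS /=; apply: contraL => /eqP; apply: cP.
suff: size (map c t) <= size (iota 0 k) by rewrite size_map size_tuple size_iota ltnn.
apply: uniq_leq_size => // _ /mapP[x /tS xS ->].
by rewrite mem_iota ck.
Qed.

Lemma chain2_free S : (forall X, X \subset S -> ~~ chain 2 X) <->
  {in S &, forall x y, ~~ lt x y}.
Proof.
split=> [hS x y xS yS|hS X /subsetP XS].
  apply/negP => xy; have /hS/negP[] : [set x; y] \subset S.
    by apply/subsetP => z; rewrite !inE => /orP[] /eqP->.
  apply/existsP; exists [tuple x; y]; rewrite /= xy /=.
  by apply/eqP/setP => z; rewrite !inE.
apply/negP => /existsP[t]; case/tupleP: t => x t; case/tupleP: t => y t.
rewrite (tuple0 t) /= andbT => /andP[xy /eqP Xt].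
have xX : x \in X by rewrite Xt !inE eqxx.
have yX : y \in X by rewrite Xt !inE eqxx orbT.
by move: xy; apply/negP/hS; apply: XS.
Qed.
End Chains.

Lemma colour_count (T : finType) (S : {set T}) (c1 c2 : T -> nat) k l D :
    {in S, forall x, c1 x < k} -> {in S, forall x, c2 x < l} ->
    (forall i j, #|[set x in S | (c1 x == i) && (c2 x == j)]| <= D) ->
  #|S| <= k * l * D.
Proof.
move=> ck cl hD; pose C (p : 'I_k * 'I_l) := [set x in S | (c1 x == p.1) && (c2 x == p.2)].
apply: (@leq_trans #|\bigcup_p C p|).
  apply/subset_leq_card/subsetP => x xS.
  apply/bigcupP; exists (Ordinal (ck x xS), Ordinal (cl x xS)) => //.
  by rewrite inE xS !eqxx.
apply: leq_trans (leq_card_bigcup _ _) _.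
apply: (@leq_trans (\sum_(p : 'I_k * 'I_l) D)); first by apply: leq_sum => p _; apply: hD.
by rewrite sum_nat_const card_prod !card_ord.
Qed.

(** * Crossing and nesting as two orders, and obstructions to page assignments *)

Section Conflicts.
Variables (d : Order.disp_t) (V : finOrderType d).
Implicit Types (e f g : V * V) (E : {set V * V}).
Local Open Scope order_scope.

(* [below true] and [below false] refine crossing and nesting of separated
   edges to strict partial orders. *)
Definition below b e f := (e.1 < f.1) && (if b then e.2 < f.2 else f.2 < e.2).

Lemma below_trans b : transitive (below b).
Proof.
move=> f e g /andP[ef1 ef2] /andP[fg1 fg2]; rewrite /below (lt_trans ef1) //=.
by case: b ef2 fg2 => [ef2 fg2|ef2 fg2]; [apply: lt_trans ef2 fg2|apply: lt_trans fg2 ef2].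
Qed.

Definition conflict b : rel (V * V) := fun e f => below b e f || below b f e.

Lemma conflict_sym b : symmetric (conflict b).
Proof. by move=> e f; rewrite /conflict orbC. Qed.

(** If both the left ends and the right ends differ, the right ends are ordered either like the left
    ends or oppositely, which is a conflict of one of the two kinds. *)
Lemma compat_share e f : compat conflict e f -> (e.1 == f.1) || (e.2 == f.2).
Proof.
move=> h; have := h true; have := h false; rewrite /conflict /below.
by case: (ltgtP e.1 f.1); case: (ltgtP e.2 f.2).
Qed.

(** Ranks turn the vertex order into natural numbers, for linear arithmetic and for relabelling
    vertices by an initial segment. *)
Definition rank (W : {set V}) x := #|[set y in W | y < x]|.

Lemma rank_lt (W : {set V}) x y : x \in W -> (rank W x < rank W y)%N = (x < y).
Proof.
move=> xW; case: (ltP x y) => [xy|yx].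
  apply/proper_card/properP; split; last by exists x; rewrite !inE ?xW ?xy ?ltxx.
  by apply/subsetP => z; rewrite !inE => /andP[-> zx]; apply: lt_trans zx xy.
apply/negbTE; rewrite -leqNgt; apply/subset_leq_card/subsetP => z.
by rewrite !inE => /andP[-> zy]; apply: lt_le_trans zy yx.
Qed.

(** Each of the three pairs shares a left or a right end, so two pairs share on the same side. *)
Lemma compat_star e f g : compat (@conflict) e f -> compat (@conflict) f g ->
    compat (@conflict) e g ->
  (e.1 = f.1 /\ f.1 = g.1) \/ (e.2 = f.2 /\ f.2 = g.2).
Proof.
move=> /compat_share ef /compat_share fg /compat_share eg.
case/orP: ef fg => /eqP ef /orP[] /eqP fg; [by left| | |by right].
  by case/orP: eg => /eqP eg; [left|right]; split; congruence.
by case/orP: eg => /eqP eg; [left|right]; split; congruence.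
Qed.

(** Both triples are stars. If their centres are on the same side, the free ends move monotonically
    along the path. Otherwise each conflict determines on which side of the opposite centre the next
    free end lies, and v3 falls on the same side as v1. *)
Lemma conflict_shortcut : shortcut (@conflict).
Proof.
move=> b u1 u2 u3 v1 v2 v3 u12 u23 u13 v12 v23 v13.
have := compat_star u12 u23 u13; have := compat_star v12 v23 v13.
have r (x y : V) : (x < y) = (rank setT x < rank setT y)%N by rewrite rank_lt ?inE.
rewrite /conflict /below !r.
by case: b => -[[-> ->]|[-> ->]] [[-> ->]|[-> ->]] /=; lia.
Qed.

Definition pages s q E := splittable (chain (below true) s.+1) (chain (below false) q.+1) E.

Lemma pages_colourable E : pages 1 1 E = colourable (@conflict) E.
Proof.
apply/existsP/existsP => -[A].
  case/split_byP => /chain2_free hA /chain2_free hB; exists A.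
  apply/colouringP => e f eE fE; rewrite /conflict.
  case eA: (e \in A) => /esym fA; rewrite negb_or.
    by rewrite !hA ?inE ?eE ?fE.
  by rewrite !hB ?inE ?eE ?fE ?eA ?fA.
move/colouringP => cA; exists A; apply/split_byP.
split; apply/chain2_free => e f; rewrite !inE => /andP[h1 h2] /andP[h3 h4].
  by have := cA _ _ h1 h3; rewrite h2 h4 negb_or => /(_ erefl)/andP[].
have := cA _ _ h2 h4; rewrite (negPf h1) (negPf h3) negb_or => /(_ erefl).
by case/andP.
Qed.

(** Applying Mirsky to both orders cuts a set without long twists and rainbows into [s * q] cells of
    pairwise compatible edges, so its size is at most [s * q * D]. The forbidden sets have at most
    [(maxn s q).+1] edges. *)
Lemma pages_obstruction s q D E :
    (forall S : {set V * V}, S \subset E -> {in S &, forall e f, compat (@conflict) e f} ->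
       (#|S| <= D)%N) ->
    ~~ pages s q E ->
  exists F : {set V * V}, [/\ F \subset E, ~~ pages s q F &
    (#|F| <= search_bound (maxn s q).+1 (s * q * D).*2.+2)%N].
Proof.
move=> hD nE; apply: small_obstruction nE => [X /card_chain cX|X /card_chain cX|S sSE].
- by rewrite (leq_trans cX) // ltnS leq_maxl.
- by rewrite (leq_trans cX) // ltnS leq_maxr.
case/mirsky => c1 [ck1 cP1] /mirsky[c2 [ck2 cP2]].
apply: (colour_count ck1 ck2) => i j; apply: hD.
  by apply: subset_trans sSE; apply/subsetP => e; rewrite inE => /andP[].
move=> e f; rewrite !inE => /and3P[eS /eqP e1 /eqP e2] /and3P[fS /eqP f1 /eqP f2].
case; rewrite /conflict negb_or.
  by rewrite !cP1 // e1 f1.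
by rewrite !cP2 // e2 f2.
Qed.

Lemma pages11_obstruction E : ~~ pages 1 1 E ->
  exists F : {set V * V}, [/\ F \subset E, ~~ pages 1 1 F & (#|F| <= 28)%N].
Proof.
rewrite pages_colourable => /(colouring_obstruction (@conflict_sym) conflict_shortcut).
by case=> F [? ? ?]; exists F; rewrite pages_colourable.
Qed.

(** Unite one small obstruction for each type in [l]. An edge outside the union could be deleted
    without making any type feasible, so the union is all of [E]. *)
Lemma critical_size (l : seq (nat * nat)) (b : nat * nat -> nat) E :
    {in l, forall p, ~~ pages p.1 p.2 E} ->
    (forall e, e \in E -> exists2 p, p \in l & pages p.1 p.2 (E :\ e)) ->
    {in l, forall p, ~~ pages p.1 p.2 E -> exists F : {set V * V},
      [/\ F \subset E, ~~ pages p.1 p.2 F & (#|F| <= b p)%N]} ->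
  (#|E| <= \sum_(p <- l) b p)%N.
Proof.
move=> nE cE hb.
have [F [sF cF hF]] : exists F : {set V * V}, [/\ F \subset E, (#|F| <= \sum_(p <- l) b p)%N &
    {in l, forall p, ~~ pages p.1 p.2 F}].
  elim: l nE hb {cE} => [|p l IHl] nE hb.
    by exists set0; rewrite sub0set cards0.
  have pl : p \in p :: l by rewrite mem_head.
  have [F [sF nF cF]] := hb p pl (nE p pl).
  have [|r rl|G [sG cG nG]] := IHl.
  - by move=> r rl; apply: nE; rewrite in_cons rl orbT.
  - by apply: hb; rewrite in_cons rl orbT.
  exists (F :|: G); split.
  - by rewrite subUset sF.
  - by rewrite big_cons (leq_trans (leq_card_setU _ _)) // leq_add.
  move=> r; rewrite in_cons => /predU1P[->|/nG].
    by apply: contra nF; apply: splittableS; apply: subsetUl.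
  by apply: contra; apply: splittableS; apply: subsetUr.
apply: leq_trans (subset_leq_card _) cF; apply/subsetP => e eE.
have [p pl pE] := cE e eE.
apply: contraTT pE => eF; apply: contra (hF p pl); apply: splittableS.
by rewrite subsetD1 sF.
Qed.
End Conflicts.

(** * Layouts of separated graphs as splittings of the edge set *)

Section Layouts.
Variable G : ograph.
Local Open Scope order_scope.
Implicit Types e f : vertex G * vertex G.

(** The form in which separation is used: the bipartition is forgotten, and deleting edges preserves
    it. *)
Definition sides_ordered := {in edges G &, forall e f, e.1 < f.2}.

Lemma separated_sides : separated G -> sides_ordered.
Proof.
case=> V1 [V2 [_ dV hE lt12]].
have side e : e \in edges G -> (e.1 \in V1) && (e.2 \in V2).
  move=> eE; case/orP: (hE e eE) => // /andP[e1 e2].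
  by have := lt_trans (edges_lt eE) (lt12 _ _ e2 e1); rewrite ltxx.
by move=> e f /side/andP[e1 _] /side/andP[_ f2]; apply: lt12.
Qed.

(** All edges of [S] share a left or right end with one fixed edge, so they lie in two stars of at
    most [D] edges each. *)
Lemma card_compat D (S : {set vertex G * vertex G}) : maxdeg_le D G ->
    S \subset edges G -> {in S &, forall e f, compat (@conflict _ _) e f} ->
  (#|S| <= D.*2)%N.
Proof.
move=> hD /subsetP sS cS; have [->|[e eS]] := set_0Vmem S; first by rewrite cards0.
pose N x := [set y : vertex G | adj x y].
have sub : S \subset [set (e.1, y) | y in N e.1] :|: [set (y, e.2) | y in N e.2].
  apply/subsetP => f fS; rewrite inE; have fE := sS _ fS.
  case/orP: (compat_share (cS _ _ eS fS)) => /eqP ef; apply/orP; [left|right].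
    by apply/imsetP; exists f.2; rewrite ?inE ?ef -?surjective_pairing // /adj -surjective_pairing fE.
  by apply/imsetP; exists f.1; rewrite ?inE ?ef -?surjective_pairing // /adj -surjective_pairing fE orbT.
rewrite (leq_trans (subset_leq_card sub)) // (leq_trans (leq_card_setU _ _)) //.
by rewrite -addnn leq_add // (leq_trans (leq_imset_card _ _)) // hD.
Qed.

Hypothesis hG : sides_ordered.

Lemma crossE : {in edges G &, forall e f, cross e f = conflict true e f}.
Proof. by move=> e f eE fE; rewrite /cross /conflict /below (hG fE eE) (hG eE fE). Qed.

Lemma nestE : {in edges G &, forall e f, nest e f = conflict false e f}.
Proof.
by move=> e f eE fE; rewrite /nest /conflict /below (edges_lt eE) (edges_lt fE).
Qed.

Lemma page_colours k (b : bool) (S : {set vertex G * vertex G}) (P : 'I_k -> {set vertex G * vertex G}) :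
    S \subset \bigcup_i P i ->
    (forall i, {in P i &, forall e f, ~~ conflict b e f}) ->
  forall X : {set _}, X \subset S -> ~~ chain (below b) k.+1 X.
Proof.
(* The colour is the page number; the default 0 never arises on [S], which the pages cover. *)
move=> sS hP; pose c e := if [pick i | e \in P i] is Some i then val i else 0%N.
have cS e : e \in S -> exists2 i, c e = val i & e \in P i.
  rewrite /c => eS; case: pickP => [i ei|ne]; first by exists i.
  by have /bigcupP[i _] := subsetP sS e eS; rewrite ne.
apply: (@chain_free _ _ _ _ c); first exact: below_trans.
split=> [e /cS[i -> _]|e f /cS[i -> ei] /cS[j -> fj] /val_inj ij]; first exact: ltn_ord.
by subst j; have := hP i _ _ ei fj; rewrite negb_or => /andP[].
Qed.

(** From a layout, [A] is the union of the stacks. Conversely, the antichain colours given by Mirsky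
    on each part serve as page numbers. *)
Lemma sq_layoutE s q : sq_layout s q G <-> pages s q (edges G).
Proof.
split=> [[P [PE Pd Ps Pq]]|/existsP[A /split_byP[/mirsky[c1 [ck1 cP1]] /mirsky[c2 [ck2 cP2]]]]].
  have sP i : P i \subset edges G by rewrite -PE bigcup_sup.
  apply/existsP; exists (\bigcup_i P (inl i)); apply/split_byP; split.
    apply: (@page_colours _ true _ (fun i => P (inl i))); first exact: subsetIr.
    move=> i e f ei fi; rewrite -crossE ?(subsetP (sP (inl i))) //.
    exact: Ps ei fi.
  apply: (@page_colours _ false _ (fun i => P (inr i))).
    apply/subsetP => e /setDP[]; rewrite -PE => /bigcupP[[i|j] _ ei] ne.
      by case/negP: ne; apply/bigcupP; exists i.
    by apply/bigcupP; exists j.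
  move=> i e f ei fi; rewrite -nestE ?(subsetP (sP (inr i))) //.
  exact: Pq ei fi.
pose P (i : 'I_s + 'I_q) : {set vertex G * vertex G} := match i with
  | inl i => [set e in edges G :&: A | c1 e == i]
  | inr j => [set e in edges G :\: A | c2 e == j] end.
exists P; split.
- apply/setP => e; apply/bigcupP/idP => [[[i|i] _]|eE].
  + by rewrite !inE => /andP[/andP[]].
  + by rewrite !inE => /andP[/andP[]].
  + case eA: (e \in A).
      have eEA : e \in edges G :&: A by rewrite inE eE.
      by exists (inl (Ordinal (ck1 e eEA))); rewrite // inE eEA eqxx.
    have eEA : e \in edges G :\: A by rewrite inE eE eA.
    by exists (inr (Ordinal (ck2 e eEA))); rewrite // inE eEA eqxx.
- move=> i j ij; rewrite -setI_eq0; apply/eqP/setP => e.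
  case: i j ij => i [] j ij; rewrite !inE; apply/negbTE/negP.
  + case/andP => /andP[_ /eqP ei] /andP[_ /eqP ej]; case/eqP: ij; congr inl.
    by apply/val_inj; rewrite /= -ei -ej.
  + by case/andP => /andP[/andP[_ ->]].
  + by case/andP => /andP[/andP[/negPf-> _] _]; rewrite andbF.
  + case/andP => /andP[_ /eqP ei] /andP[_ /eqP ej]; case/eqP: ij; congr inr.
    by apply/val_inj; rewrite /= -ei -ej.
- move=> i e f; rewrite !inE => /andP[/andP[eE eA] /eqP ei] /andP[/andP[fE fA] /eqP fi].
  by rewrite crossE // negb_or !cP1 ?inE ?eE ?fE // ei fi.
- move=> i e f; rewrite !inE => /andP[/andP[eE eA] /eqP ei] /andP[/andP[fE fA] /eqP fi].
  by rewrite nestE // negb_or !cP2 ?inE ?eE ?eA ?fE ?fA // ei fi.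
Qed.
End Layouts.

Lemma del_sides_ordered (G : ograph) (e : vertex G * vertex G) :
  sides_ordered G -> sides_ordered (del_edge e).
Proof. by move=> hG x y /setD1P[_ xE] /setD1P[_ yE]; apply: hG. Qed.

Lemma card_critical (G : ograph) (layout : ograph -> Prop) (l : seq (nat * nat))
    (b : nat * nat -> nat) :
    separated G ->
    (forall H, layout H <-> exists2 p, p \in l & sq_layout p.1 p.2 H) ->
    critical layout G ->
    {in l, forall p, ~~ pages p.1 p.2 (edges G) -> exists F : {set vertex G * vertex G},
      [/\ F \subset edges G, ~~ pages p.1 p.2 F & #|F| <= b p]} ->
  #|edges G| <= \sum_(p <- l) b p.
Proof.
move=> /separated_sides hG lE [nG cG]; apply: critical_size => [p pl|e eE].
  by apply/negP => /(sq_layoutE hG) Gp; apply: nG; apply/lE; exists p.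
have /lE[p pl hp] := cG e eE; exists p => //.
by have := sq_layoutE (@del_sides_ordered G e hG) p.1 p.2; case=> /(_ hp).
Qed.

(** * Finitely many representatives for a bounded number of edges *)

Section Finiteness.
Variable M : nat.

Lemma rep_lt (S : {set 'I_M * 'I_M}) e :
  e \in [set e in S | (e.1 < e.2)%O] -> (e.1 < e.2)%O.
Proof. by rewrite inE => /andP[]. Qed.

(** Discarding non-increasing pairs makes every [S] a graph, so representatives can be indexed by
    all sets of pairs. *)
Definition rep S := OGraph (@rep_lt S).

Lemma adj_nonisolated (G : ograph) (x y : vertex G) : adj x y -> x \in nonisolated G.
Proof. by move=> xy; rewrite inE; apply/existsP; exists y. Qed.

Lemma adjC (G : ograph) (x y : vertex G) : adj x y = adj y x.
Proof. by rewrite /adj orbC. Qed.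

Lemma card_nonisolated (G : ograph) : #|nonisolated G| <= #|edges G|.*2.
Proof.
have sub : nonisolated G \subset [set e.1 | e in edges G] :|: [set e.2 | e in edges G].
  apply/subsetP => x; rewrite !inE => /existsP[y /orP[] xy]; apply/orP.
    by left; apply/imsetP; exists (x, y).
  by right; apply/imsetP; exists (y, x).
rewrite (leq_trans (subset_leq_card sub)) // (leq_trans (leq_card_setU _ _)) //.
by rewrite -addnn leq_add // leq_imset_card.
Qed.

(** Relabel each non-isolated vertex by its rank among them; there are at most twice as many as
    edges, so the ranks fit below [M]. *)
Lemma ograph_iso_rep (G : ograph) : #|edges G|.*2 <= M -> exists S, ograph_iso G (rep S).
Proof.
move=> eM; set W := nonisolated G.
have rM x : x \in W -> rank W x < M.
  move=> xW; apply: leq_trans (leq_trans (card_nonisolated G) eM).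
  apply/proper_card/properP; split; last by exists x; rewrite // inE ltxx andbF.
  by apply/subsetP => z; rewrite inE => /andP[].
pose r (u : {x | x \in W}) : 'I_M := Ordinal (rM _ (valP u)).
have r_lt u v : (r u < r v)%O = (val u < val v)%O by rewrite -(rank_lt _ (valP u)).
have r_inj : injective r.
  move=> u v uv; apply/val_inj; apply/eqP; rewrite eq_le !leNgt -!r_lt uv.
  by rewrite ltxx.
pose S := [set ((r p.1), (r p.2)) | p in [set p | (val p.1, val p.2) \in edges G]].
have SE u v : ((r u, r v) \in S) = ((val u, val v) \in edges G).
  apply/imsetP/idP => [[[u' v']]|uv]; last by exists (u, v); rewrite ?inE.
  rewrite inE => uv /eqP; rewrite xpair_eqE.
  by case/andP => /eqP/r_inj-> /eqP/r_inj->.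
have edgeE u v : ((r u, r v) \in edges (rep S)) = ((val u, val v) \in edges G).
  by rewrite inE SE /= r_lt; case: (boolP (_ \in _)) => // /edges_lt ->.
have adjE u v : adj (r u : vertex (rep S)) (r v) = adj (val u) (val v).
  by rewrite /adj !edgeE.
exists S.
have rW u : (r u : vertex (rep S)) \in nonisolated (rep S).
  have := valP u; rewrite inE => /existsP[y uy].
  have yW : y \in W by apply: (@adj_nonisolated _ _ (val u)); rewrite adjC.
  by apply: (@adj_nonisolated (rep S) (r u) (r (exist _ y yW))); rewrite adjE.
pose f u : {y | y \in nonisolated (rep S)} :=
  exist _ (r u : vertex (rep S)) (rW u).
exists f; split=> //.
apply: inj_card_bij => [u v /(congr1 val)/r_inj//|].
(* Every edge of the representative joins two labels in the image of [r], so counting upgrades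
   injectivity to bijectivity. *)
rewrite -(card_codom r_inj) card_sig; apply/subset_leq_card/subsetP => y.
rewrite inE => /existsP[z]; have inS a c : (a, c) \in edges (rep S) ->
    (a \in codom r) && (c \in codom r).
  rewrite inE => /andP[/imsetP[[u v] _ /eqP ac] _]; move: ac.
  by rewrite xpair_eqE => /andP[/eqP-> /eqP->]; rewrite !codom_f.
by case/orP=> /inS/andP[].
Qed.

End Finiteness.

Lemma finitely_many_bounded (P : ograph -> Prop) N :
  (forall G, P G -> #|edges G| <= N) -> finitely_many P.
Proof.
move=> hP; exists #|{: {set 'I_N.*2 * 'I_N.*2}}|, (fun i => rep (enum_val i)) => G /hP GN.
have [S hS] := @ograph_iso_rep N.*2 G (etrans (leq_double _ _) GN).
by exists (enum_rank S); rewrite enum_rankK.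
Qed.

(** * Uniform treatment of both kinds of criticality through lists of page types *)

Definition mixed_types k := [seq (s, k - s) | s <- iota 0 k.+1].

Lemma mixed_layoutE k H :
  mixed_layout k H <-> exists2 p, p \in mixed_types k & sq_layout p.1 p.2 H.
Proof.
split=> [[s [q [sq hH]]]|[_ /mapP[s + ->] hH]].
  exists (s, q) => //; apply/mapP; exists s; last by rewrite -sq addKn.
  by rewrite mem_iota /= ltnS -sq leq_addr.
by rewrite mem_iota ltnS => sk; exists s, (k - s); rewrite subnKC.
Qed.

Lemma sq_layout1E s q H :
  sq_layout s q H <-> exists2 p, p \in [:: (s, q)] & sq_layout p.1 p.2 H.
Proof. by split=> [hH|[p /[!inE]/eqP->]//]; exists (s, q); rewrite ?mem_head. Qed.

Definition obstruction_bound D (p : nat * nat) :=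
  search_bound (maxn p.1 p.2).+1 (p.1 * p.2 * D).*2.+2.

Lemma finitely_many_maxdeg (layout : ograph -> Prop) (l : seq (nat * nat)) D :
    (forall H, layout H <-> exists2 p, p \in l & sq_layout p.1 p.2 H) ->
  finitely_many (fun G => [/\ separated G, maxdeg_le D G & critical layout G]).
Proof.
move=> lE; apply: (@finitely_many_bounded _ (\sum_(p <- l) obstruction_bound D.*2 p)).
move=> G [sG dG cG]; apply: (card_critical sG lE cG) => p _.
by apply: pages_obstruction => S; apply: card_compat.
Qed.

Lemma unbounded_obstruction d (V : finOrderType d) (E : {set V * V}) p :
    p \in (1, 1) :: mixed_types 2 -> ~~ pages p.1 p.2 E ->
  exists F : {set V * V}, [/\ F \subset E, ~~ pages p.1 p.2 F &
    #|F| <= maxn 28 (obstruction_bound 0 p)].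
Proof.
have [->|p11] := eqVneq p (1, 1).
  move=> _ /pages11_obstruction[F [? ? cF]]; exists F; split; [by []|by []|].
  exact: leq_trans cF (leq_maxl _ _).
move=> pl nE.
(* One component of [p] is zero, so [p.1 * p.2 * D = 0] for every [D] and no
   degree bound is needed. *)
have [S _ _|F [? ? cF]] := @pages_obstruction _ _ p.1 p.2 #|{: V * V}| E _ nE.
  exact: max_card.
exists F; split=> //; rewrite leq_max; apply/orP; right.
by move: pl cF p11; rewrite !inE => /or4P[] /eqP->.
Qed.

Lemma finitely_many_two_pages (layout : ograph -> Prop) (l : seq (nat * nat)) :
    {subset l <= (1, 1) :: mixed_types 2} ->
    (forall H, layout H <-> exists2 p, p \in l & sq_layout p.1 p.2 H) ->
  finitely_many (fun G => separated G /\ critical layout G).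
Proof.
move=> sl lE.
apply: (@finitely_many_bounded _ (\sum_(p <- l) maxn 28 (obstruction_bound 0 p))).
move=> G [sG cG]; apply: (card_critical sG lE cG) => p /sl.
exact: unbounded_obstruction.
Qed.

Theorem theorem9 :
  (forall s q k Delta : nat, 0 < s -> 0 < q -> 0 < k ->
     finitely_many
       (fun G => [/\ separated G, maxdeg_le Delta G & sq_critical s q G]) /\
     finitely_many
       (fun G => [/\ separated G, maxdeg_le Delta G & k_critical k G])) /\
  (finitely_many (fun G => separated G /\ sq_critical 1 1 G) /\
   finitely_many (fun G => separated G /\ k_critical 2 G)).
Proof.
split=> [s q k D _ _ _|].
  split; first exact: finitely_many_maxdeg (sq_layout1E s q).
  exact: finitely_many_maxdeg (mixed_layoutE k).
split.
  by apply: finitely_many_two_pages (sq_layout1E 1 1) => p; rewrite !inE => ->.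
by apply: finitely_many_two_pages (mixed_layoutE 2) => p pl; rewrite in_cons pl orbT.
Qed.
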